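(* Let $\mathfrak{G}=\langle \delta,\tau \mid \delta^2,\tau^2,(\delta\tau)^3\rangle$ and $\mathfrak{S}=\langle *,+ \mid *^2,+^2,( *+)^3\rangle$ be two presentations of the symmetric group of degree three, and let $\eta:\mathfrak{G}\rightarrow\mathfrak{S}$ be the homomorphism induced by $\eta(\delta)=*$ and $\eta(\tau)=+$. If $G$ is a ribbon graph, $A_1,\ldots,A_n\subseteq E(G)$, and $g_1,\ldots,g_n\in\mathfrak{G}$, then $$D\big(G^{g_1(A_1)g_2(A_2)\cdots g_n(A_n)}\big) = D(G)\,\eta(g_1)(A_1)\,\eta(g_2)(A_2)\cdots\eta(g_n)(A_n).$$
   Context: A ribbon graph $G=(V(G),E(G))$ is a surface with boundary represented as the union of two (finite) sets of discs, a set $V(G)$ of vertices and a set $E(G)$ of edges, such that: the vertices and edges intersect in disjoint line segments; each such line segment lies on the boundary of precisely one vertex and precisely one edge; and every edge contains exactly two such line segments. For $B\subseteq E(G)$, the spanning ribbon subgraph on $B$ is $(V(G),B)$. Below, the edge sets of all ribbon graphs constructed from $G$ are identified with $E(G)$. Partial dual: for $A\subseteq E(G)$, $G^{\delta(A)}=G^A$ is obtained as follows. Regard the boundary components of the spanning ribbon subgraph $(V(G),A)$ as curves on the surface of $G$; glue a disc to $G$ along each of these curves (these discs are the new vertices) and remove the interiors of all vertices of $G$. Partial Petrial: $G^{\tau(A)}$ is obtained from $G$ by, for each $e\in A$, choosing one of the two arcs $(a,b)$ where $e$ meets a vertex, detaching $e$ along that arc, and reattaching it with the direction of the arc reversed (adding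 a half-twist to $e$). For a word $w=w_1w_2\cdots w_m$ in $\{\delta,\tau\}$, $G^{w(A)}:=(\cdots((G^{w_1(A)})^{w_2(A)})\cdots)^{w_m(A)}$; it is known that this depends only on the element of $\mathfrak{G}$ represented by $w$, so $G^{g(A)}$ is defined for $g\in\mathfrak{G}$. Also $G^{g(A)h(B)}:=(G^{g(A)})^{h(B)}$, and similarly for longer products. A set system is a pair $S=(E,\mathcal{F})$ with $E$ a finite set and $\mathcal{F}$ a collection of subsets of $E$ (the feasible sets). With $\bigtriangleup$ denoting symmetric difference, for $A\subseteq E$ the twist is $S*A=(E,\{A\bigtriangleup X: X\in\mathcal{F}\})$. For $e\in E$, $S+e=(E,\mathcal{F}\bigtriangleup\{F\cup\{e\}: F\in\mathcal{F}, e\notin F\})$, and for $A=\{e_1,\ldots,e_m\}$ the loop complementation is $S+A=S+e_1+\cdots+e_m$ (order immaterial). For a word $w=w_1\cdots w_m$ in $\{*,+\}$, $S\,w(A):=(\cdots((S\,w_1(A))\,w_2(A))\cdots)w_m(A)$, where $S\,{*}(A)=S*A$ and $S\,{+}(A)=S+A$; it is known that this depends only on the element of $\mathfrak{S}$ represented by $w$. Also $S\,g(A)h(B):=(S\,g(A))\,h(B)$, and similarly for longer products. A quasi-tree is a ribbon graph with exactly one boundary component. The delta-matroid of $G$ is the set system $D(G)=(E(G),\mathcal{F})$ where $\mathcal{F}$ consists of the edge sets of the spanning ribbon subgraphs of $G$ that form a quasi-tree when restricted to each connected component of $G$. *)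

(* Defs.v *)
From HB Require Import structures.
From mathcomp Require Import all_boot.
From mathcomp Require Import generic_quotient boolp.

Set Implicit Arguments.
Unset Strict Implicit.
Unset Printing Implicit Defensive.

Local Open Scope group_scope.
Local Open Scope quotient_scope.

(* Groups presented by involutory generators: since every [:: x; x] is a      *)
(* relator, each generator is its own inverse and words need no formal        *)
(* inverse letters.                                                           *)

Record inv_presentation := InvPresentation {
  gen : choiceType;
  relators : seq (seq gen);
  gen_invol : forall x : gen, [:: x; x] \in relators }.

Inductive word_eq (P : inv_presentation) : seq (gen P) -> seq (gen P) -> Prop :=
| WordEqRefl u : word_eq u u
| WordEqSym u v : word_eq u v -> word_eq v u
| WordEqTrans u v w : word_eq u v -> word_eq v w -> word_eq u w
| WordEqRel u r v : r \in relators P -> word_eq (u ++ r ++ v) (u ++ v).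

Section PresentedGroup.

Variable P : inv_presentation.
Implicit Types u v w : seq (gen P).

Definition word_eqb : rel (seq (gen P)) := fun u v => `[< word_eq u v >].

Lemma word_eqb_refl : reflexive word_eqb.
Proof. by move=> u; apply/asboolP; apply: WordEqRefl. Qed.

Lemma word_eqb_sym : symmetric word_eqb.
Proof. by move=> u v; apply/asboolP/asboolP; apply: WordEqSym. Qed.

Lemma word_eqb_trans : transitive word_eqb.
Proof.
by move=> v u w /asboolP uv /asboolP vw; apply/asboolP; apply: WordEqTrans vw.
Qed.

Canonical word_equiv :=
  EquivRel word_eqb word_eqb_refl word_eqb_sym word_eqb_trans.

Definition presented := {eq_quot word_equiv}.
HB.instance Definition _ := Choice.on presented.
HB.instance Definition _ := EqQuotient.on presented.

Definition word_class (u : seq (gen P)) : presented := \pi_presented u.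

Lemma word_classP u v : word_eq u v <-> word_class u = word_class v.
Proof.
by split=> [uv|/eqP]; [apply/eqP|]; rewrite eqmodE => *; apply/asboolP.
Qed.

Lemma repr_word_class (g : presented) : word_class (repr g) = g.
Proof. exact: reprK. Qed.

Lemma word_eq_repr u : word_eq (repr (word_class u)) u.
Proof. by apply/word_classP; rewrite repr_word_class. Qed.

Lemma word_eq_catl u v w : word_eq v w -> word_eq (u ++ v) (u ++ w).
Proof.
elim=> {v w} [v|v w _|v w t _ IH1 _|v r w rR].
- exact: WordEqRefl.
- exact: WordEqSym.
- exact: WordEqTrans.
- by rewrite !(catA u v); apply: WordEqRel.
Qed.

Lemma word_eq_catr u v w : word_eq v w -> word_eq (v ++ u) (w ++ u).
Proof.
elim=> {v w} [v|v w _|v w t _ IH1 _|v r w rR].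
- exact: WordEqRefl.
- exact: WordEqSym.
- exact: WordEqTrans.
- by rewrite -!catA; apply: WordEqRel.
Qed.

Lemma word_eq_cat u u' v v' :
  word_eq u u' -> word_eq v v' -> word_eq (u ++ v) (u' ++ v').
Proof.
move=> uu vv; apply: (@WordEqTrans _ _ (u' ++ v)); first exact: word_eq_catr.
exact: word_eq_catl.
Qed.

Lemma word_eq_rev_cat u : word_eq (rev u ++ u) [::].
Proof.
elim: u => [|x u IH]; first exact: WordEqRefl.
rewrite rev_cons -cats1 -catA; apply: WordEqTrans IH.
exact: (WordEqRel _ _ (gen_invol x)).
Qed.

Lemma word_eq_rev u v : word_eq u v -> word_eq (rev u) (rev v).
Proof.
move=> uv; apply: (@WordEqTrans _ _ (rev u ++ v ++ rev v)).
  rewrite -{1}[rev u]cats0; apply: word_eq_catl; apply: WordEqSym.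
  by have := word_eq_rev_cat (rev v); rewrite revK.
rewrite catA -[in X in word_eq _ X](cat0s (rev v)); apply: word_eq_catr.
apply: WordEqTrans (word_eq_rev_cat u); apply: word_eq_catl; exact: WordEqSym.
Qed.

Definition presented_one : presented := word_class [::].
Definition presented_mul (g h : presented) : presented :=
  word_class (repr g ++ repr h).
Definition presented_inv (g : presented) : presented :=
  word_class (rev (repr g)).

Lemma presented_mulE u v :
  presented_mul (word_class u) (word_class v) = word_class (u ++ v).
Proof. by apply/word_classP/word_eq_cat; apply: word_eq_repr. Qed.

Lemma presented_invE u : presented_inv (word_class u) = word_class (rev u).
Proof. by apply/word_classP/word_eq_rev/word_eq_repr. Qed.

Lemma presented_mulA : associative presented_mul.
Proof.
move=> g h k; rewrite -[g]repr_word_class -[h]repr_word_class.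
rewrite -[k]repr_word_class (presented_mulE (repr h)) (presented_mulE (repr g)).
by rewrite (presented_mulE (repr g)) (presented_mulE (_ ++ _)) catA.
Qed.

Lemma presented_mul1 : left_id presented_one presented_mul.
Proof. by move=> g; rewrite -[g]repr_word_class presented_mulE. Qed.

Lemma presented_mulr1 : right_id presented_one presented_mul.
Proof. by move=> g; rewrite -[g]repr_word_class presented_mulE cats0. Qed.

Lemma presented_mulV : left_inverse presented_one presented_inv presented_mul.
Proof.
move=> g; rewrite -[g]repr_word_class presented_invE presented_mulE.
exact/word_classP/word_eq_rev_cat.
Qed.

Lemma presented_mulrV : right_inverse presented_one presented_inv presented_mul.
Proof.
move=> g; rewrite -[g]repr_word_class presented_invE presented_mulE.
by apply/word_classP; rewrite -{1}[repr g]revK; apply: word_eq_rev_cat.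
Qed.

HB.instance Definition _ := isGroup.Build presented
  presented_mulA presented_mul1 presented_mulr1 presented_mulV presented_mulrV.

Lemma word_classM u v : word_class (u ++ v) = word_class u * word_class v.
Proof. exact/esym/presented_mulE. Qed.

End PresentedGroup.

(* The groups frakG = < delta, tau > and frakS = < *, + >.                    *)

Variant ribbon_op := Delta | Tau.
Variant set_op := Star | Plus.

Definition ribbon_op_bool x := if x is Delta then true else false.
Definition bool_ribbon_op (b : bool) := if b then Delta else Tau.
Lemma ribbon_op_boolK : cancel ribbon_op_bool bool_ribbon_op.
Proof. by case. Qed.
HB.instance Definition _ := Countable.copy ribbon_op (can_type ribbon_op_boolK).

Definition set_op_bool x := if x is Star then true else false.
Definition bool_set_op (b : bool) := if b then Star else Plus.
Lemma set_op_boolK : cancel set_op_bool bool_set_op.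
Proof. by case. Qed.
HB.instance Definition _ := Countable.copy set_op (can_type set_op_boolK).

Definition S3_relators (X : Type) (a b : X) : seq (seq X) :=
  [:: [:: a; a]; [:: b; b]; [:: a; b; a; b; a; b]].

Lemma ribbon_op_invol x : [:: x; x] \in S3_relators Delta Tau.
Proof. by case: x. Qed.

Lemma set_op_invol x : [:: x; x] \in S3_relators Star Plus.
Proof. by case: x. Qed.

Definition frakG_pres := InvPresentation ribbon_op_invol.
Definition frakS_pres := InvPresentation set_op_invol.
Definition frakG := presented frakG_pres.
Definition frakS := presented frakS_pres.

Definition delta : frakG := @word_class frakG_pres [:: Delta].
Definition tau : frakG := @word_class frakG_pres [:: Tau].
Definition star : frakS := @word_class frakS_pres [:: Star].
Definition plus : frakS := @word_class frakS_pres [:: Plus].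

(* The homomorphism with eta delta = star and eta tau = plus exists.          *)

Definition eta_gen (x : ribbon_op) := if x is Delta then Star else Plus.

Definition eta_hom (g : frakG) : frakS :=
  @word_class frakS_pres (map eta_gen (repr g)).

Lemma eta_gen_word_eq u v :
  @word_eq frakG_pres u v -> @word_eq frakS_pres (map eta_gen u) (map eta_gen v).
Proof.
elim=> {u v} [u|u v _|u v w _ IH1 _|u r v rR].
- exact: WordEqRefl.
- exact: WordEqSym.
- exact: WordEqTrans.
- rewrite !map_cat; apply: (@WordEqRel frakS_pres).
  by move: rR; rewrite /= !inE => /or3P[]/eqP->.
Qed.

Lemma eta_homE (w : seq ribbon_op) :
  eta_hom (@word_class frakG_pres w) = @word_class frakS_pres (map eta_gen w).
Proof. exact/word_classP/eta_gen_word_eq/word_eq_repr. Qed.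

Lemma eta_homM : {morph eta_hom : g h / g * h}.
Proof.
move=> g h; rewrite -[g]repr_word_class -[h]repr_word_class.
by rewrite -word_classM !eta_homE map_cat word_classM.
Qed.

HB.instance Definition _ :=
  isMultiplicative.Build frakG frakS eta_hom eta_homM.

Lemma eta_hom_delta : eta_hom delta = star. Proof. exact: eta_homE. Qed.
Lemma eta_hom_tau : eta_hom tau = plus. Proof. exact: eta_homE. Qed.

(* Set systems with ground set E, given by their families of feasible sets.   *)

Section SymmetricDifference.

Variable T : finType.
Implicit Types A B C : {set T}.

Definition symdiff A B := (A :\: B) :|: (B :\: A).

Lemma in_symdiff A B x : (x \in symdiff A B) = (x \in A) (+) (x \in B).
Proof. by rewrite !inE; case: (x \in A); case: (x \in B). Qed.

End SymmetricDifference.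

Definition set_system (E : finType) := {set {set E}}.

Section SetSystems.

Variable E : finType.
Implicit Types (S : set_system E) (A X Y : {set E}) (e : E).

Definition twist A S : set_system E := [set symdiff A X | X in S].

Definition loop_complement1 S e : set_system E :=
  symdiff S [set e |: X | X in S & e \notin X].

Definition loop_complement A S : set_system E :=
  foldl loop_complement1 S (enum A).

Definition set_op_act (x : set_op) A S :=
  match x with Star => twist A S | Plus => loop_complement A S end.

End SetSystems.

(* Ribbon graphs with edge set E, recorded up to homeomorphism by the way the *)
(* vertex discs are glued to the edge discs.  The boundary circle of an edge  *)
(* disc e carries four corners (e, i, j): the arc {(e, i, 0), (e, i, 1)} is   *)
(* the line segment in which the end i of e meets a vertex, and the two       *)
(* remaining segments {(e, 0, j), (e, 1, j)} are the free sides of e.  The    *)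
(* arcs cut the boundary circle of a vertex disc into free segments; link     *)
(* sends a corner to the other endpoint of its free segment.  As the circles  *)
(* formed by arcs and free segments bound the vertex discs, every             *)
(* fixed-point free involution arises.  Vertices that meet no edge have no    *)
(* corner and are listed separately.                                          *)

Definition corner (E : finType) : finType := (E * bool * bool)%type.

Record ribbon_graph (E : finType) := RibbonGraph {
  isolated : finType;
  link : corner E -> corner E;
  linkK : involutive link;
  link_neq : forall c, link c != c }.

Section RibbonGraphs.

Variable E : finType.
Implicit Types (A B : {set E}) (G : ribbon_graph E) (c : corner E).

Definition across_arc c : corner E := let: (e, i, j) := c in (e, i, ~~ j).
Definition along_side c : corner E := let: (e, i, j) := c in (e, ~~ i, j).

Lemma across_arcK : involutive across_arc.
Proof. by move=> [[e i] j] /=; rewrite negbK. Qed.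

Lemma along_sideK : involutive along_side.
Proof. by move=> [[e i] j] /=; rewrite negbK. Qed.

(* Boundary of (V(G), B) at a corner of e: it follows a side of e if e is in  *)
(* B, and otherwise the arc left on the vertex when e is removed.             *)
Definition follow B c : corner E :=
  if c.1.1 \in B then along_side c else across_arc c.

Lemma followK B : involutive (follow B).
Proof.
move=> [[e i] j]; rewrite /follow /=.
by case eB: (e \in B); rewrite /= eB /= negbK.
Qed.

(* The pieces into which moves between corners divide the corners of G; an    *)
(* isolated vertex is always a piece of its own.                              *)

Definition site G : finType := (corner E + isolated G)%type.

Definition site_move G (f : corner E -> corner E) (x : site G) : site G :=
  match x with inl c => inl (f c) | inr v => inr v end.

Definition site_step G (fs : seq (corner E -> corner E)) : rel (site G) :=
  fun x y => has (fun f => y == site_move f x) fs.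

Definition pieces G (fs : seq (corner E -> corner E)) : {set {set site G}} :=
  [set [set y | connect (site_step fs) x y] | x : site G].

Definition vertices G := pieces G [:: link G; across_arc].
Definition boundary G B := pieces G [:: link G; follow B].
Definition components G := pieces G [:: link G; across_arc; along_side].

Definition delta_matroid G : set_system E :=
  [set B : {set E} |
     [forall K in components G, #|[set b in boundary G B | b \subset K]| == 1%N]].

Section Reglue.

Variables (G : ribbon_graph E) (f : corner E -> corner E) (fK : involutive f).

Lemma reglueK : involutive (fun c => f (link G (f c))).
Proof. by move=> c; rewrite fK linkK fK. Qed.

Lemma reglue_neq c : f (link G (f c)) != c.
Proof. by rewrite -{2}[c]fK (inj_eq (inv_inj fK)) link_neq. Qed.

(* The free segment that ended at the corner c now ends at f c.               *)
Definition reglue : ribbon_graph E :=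
  RibbonGraph (isolated G) reglueK reglue_neq.

End Reglue.

(* Partial dual: a free segment of a vertex is also a segment of the boundary *)
(* of (V(G), A), hence of a new vertex.  The new vertices meet an edge of A   *)
(* along its former sides.                                                    *)
Definition dual_corner A c : corner E :=
  let: (e, i, j) := c in if e \in A then (e, j, i) else c.

Lemma dual_cornerK A : involutive (dual_corner A).
Proof. by move=> [[e i] j] /=; case eA: (e \in A); rewrite /= eA. Qed.

Definition partial_dual A G := reglue G (dual_cornerK A).

(* Partial Petrial: the end (p e) of each edge e of A is detached and its arc *)
(* is reattached in the reverse direction.                                    *)
Definition petrial_corner (p : E -> bool) A c : corner E :=
  let: (e, i, j) := c in if (e \in A) && (i == p e) then (e, i, ~~ j) else c.

Lemma petrial_cornerK p A : involutive (petrial_corner p A).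
Proof. by move=> [[e i] j] /=; case eA: (_ && _); rewrite /= eA ?negbK. Qed.

Definition partial_petrial_at p A G := reglue G (petrial_cornerK p A).
Definition partial_petrial A G := partial_petrial_at (fun=> true) A G.

Definition ribbon_op_act (x : ribbon_op) A G :=
  match x with Delta => partial_dual A G | Tau => partial_petrial A G end.

End RibbonGraphs.

(* Action of a word, read from left to right, and of a group element.         *)

Definition word_act (X S T : Type) (op : X -> S -> T -> T) (w : seq X) (A : S)
  (t : T) : T := foldl (fun t x => op x A t) t w.

(* G^{g(A)} and S g(A), through a chosen word representing g; by              *)
(* ribbon_act_word and system_act_word below, any other word would do.        *)
Definition ribbon_act E (g : frakG) (A : {set E}) (G : ribbon_graph E) :=
  word_act (@ribbon_op_act E) (repr g) A G.
Definition system_act E (g : frakS) (A : {set E}) (S : set_system E) :=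
  word_act (@set_op_act E) (repr g) A S.

(* The product t g_1(A_1) ... g_n(A_n), applied from left to right.           *)
Definition iter_act (X S T : Type) (act : X -> S -> T -> T) (n : nat)
  (g : 'I_n -> X) (A : 'I_n -> S) (t : T) : T :=
  foldl (fun t i => act (g i) (A i) t) t (enum 'I_n).

Lemma vertices_boundary0 E (G : ribbon_graph E) : vertices G = boundary G set0.
Proof.
apply: eq_imset => x; apply/setP => y; rewrite !inE; apply: eq_connect => u v.
by rewrite /site_step /=; case: u => [[[e i] j]|u]; rewrite /follow /= ?inE.
Qed.

Lemma vertices_partial_dual E (A : {set E}) (G : ribbon_graph E) :
  vertices (partial_dual A G) =
  [set [set site_move (dual_corner A) x | x in b] | b : {set site G} in boundary G A].
Proof.
have sK : involutive (@site_move _ G (dual_corner A)).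
  by case=> [c|v] //=; rewrite dual_cornerK.
have stepE (x y : site G) :
    @site_step _ (partial_dual A G) [:: link (partial_dual A G); @across_arc E]
      (site_move (dual_corner A) x) (site_move (dual_corner A) y) =
    site_step [:: link G; follow A] x y.
  rewrite /site_step /= !orbF; congr (_ || _);
    rewrite -[RHS](inj_eq (inv_inj sK)); congr (_ == _).
    by case: x => [c|v] //=; rewrite dual_cornerK.
  case: x => [[[e i] j]|v] //=; congr inl; rewrite /follow /=.
  by case eA: (e \in A); rewrite /= eA.
have conn_homo (r r' : rel (site G)) (h : site G -> site G) x y :
    (forall u v, r u v -> r' (h u) (h v)) -> connect r x y ->
    connect r' (h x) (h y).
  move=> rr' /connectP[p]; elim: p x => [x _ -> //|z p IH x /= /andP[xz zp] yE].
  exact: connect_trans (connect1 (rr' _ _ xz)) (IH _ zp yE).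
have connE (x y : site G) :
    connect (@site_step _ (partial_dual A G)
      [:: link (partial_dual A G); @across_arc E])
      (site_move (dual_corner A) x) (site_move (dual_corner A) y) =
    connect (site_step [:: link G; follow A]) x y.
  apply/idP/idP; last by apply: conn_homo => u v; rewrite stepE.
  rewrite -{2}[x]sK -{2}[y]sK; apply: conn_homo => u v.
  by rewrite -stepE !sK.
have pieceE (x : site G) :
    [set y | connect (@site_step _ (partial_dual A G)
      [:: link (partial_dual A G); @across_arc E])
      (site_move (dual_corner A) x) y] =
    [set site_move (dual_corner A) y
       | y in [set y | connect (site_step [:: link G; follow A]) x y]].
  apply/setP => y; rewrite -[y]sK inE connE (mem_imset _ _ (inv_inj sK)).
  by rewrite inE.
apply/setP => b; apply/imsetP/imsetP => [[x _ ->]|[_ /imsetP[x _ ->] ->]].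
  exists [set y | connect (site_step [:: link G; follow A])
                    (site_move (dual_corner A) x) y].
    by apply: imset_f.
  by rewrite -pieceE sK.
by exists (site_move (dual_corner A) x); rewrite // pieceE.
Qed.

Section WellDefined.

Variables (P : inv_presentation) (S T : Type) (op : gen P -> S -> T -> T).
Hypothesis op_relators :
  forall r A t, r \in relators P -> word_act op r A t = t.

Lemma word_act_eq u v A t : word_eq u v -> word_act op u A t = word_act op v A t.
Proof.
move=> uv; elim: uv t => {u v} // [u v w _ IH1 _ IH2 t|u r v rR t].
- by rewrite IH1 IH2.
- by rewrite /word_act !foldl_cat -/(word_act op r A _) op_relators.
Qed.

Lemma word_act_repr w A t :
  word_act op (repr (@word_class P w)) A t = word_act op w A t.
Proof. exact/word_act_eq/word_eq_repr. Qed.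

End WellDefined.

Lemma ribbon_graph_eq E (I : finType) (l l' : corner E -> corner E) lK lN l'K l'N :
  l =1 l' -> @RibbonGraph E I l lK lN = @RibbonGraph E I l' l'K l'N.
Proof.
move=> /funext ll; case: l' / ll l'K l'N => l'K l'N.
by rewrite (Prop_irrelevance lK l'K) (Prop_irrelevance lN l'N).
Qed.

(* The choice of ends is immaterial up to reparametrizing edge discs.         *)
Lemma partial_petrial_arcE (E : finType) (p : E -> bool) (A : {set E}) G :
  exists f : corner E -> corner E,
    [/\ involutive f, forall c, (f c).1.1 = c.1.1,
        {morph f : c / across_arc c}, {morph f : c / along_side c} &
        forall c, link (partial_petrial_at p A G) c =
                  f (link (partial_petrial A G) (f c))].
Proof.
pose f : corner E -> corner E := fun c =>
  let: (e, i, j) := c in if (e \in A) && ~~ p e then (e, i, ~~ j) else c.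
have fE c : petrial_corner p A c = f (petrial_corner (fun=> true) A c).
  case: c => [[e i] j] /=; case eA: (e \in A) => /=; last by rewrite eA.
  by case: i; case pe: (p e); rewrite /= ?eA ?pe //= negbK.
have fE' c : petrial_corner p A c = petrial_corner (fun=> true) A (f c).
  case: c => [[e i] j] /=; case eA: (e \in A) => /=; last by rewrite eA.
  by case: i; case pe: (p e); rewrite /= ?eA ?pe //= negbK.
exists f; split=> [[[e i] j]|[[e i] j]|[[e i] j]|[[e i] j]|c] /=.
- by case eA: (_ && _); rewrite /= eA ?negbK.
- by case: ifP.
- by case: ifP.
- by case: ifP.
- by rewrite fE -fE'.
Qed.

Lemma ribbon_act_word (E : finType) (w : seq ribbon_op) (A : {set E}) G :
  ribbon_act (@word_class frakG_pres w) A G = word_act (@ribbon_op_act E) w A G.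
Proof.
apply: (@word_act_repr frakG_pres) => r {}A {}G.
pose d := @dual_corner E A; pose t := @petrial_corner E (fun=> true) A.
have dt c : t (d (t (d (t (d c))))) = c.
  rewrite /t /d; case: c => [[e i] j] /=; case eA: (e \in A) => /=.
    by case: i; case: j; rewrite /= ?eA /= ?eA /= ?eA /= ?eA /= ?eA.
  by rewrite eA /= eA /= eA /= eA /= eA.
have td c : d (t (d (t (d (t c))))) = c.
  have dd : involutive d := dual_cornerK A.
  by have := dt (d c); rewrite dd => ->.
case: G => I l lK lN; rewrite /= !inE => /or3P[]/eqP-> /=;
  apply: ribbon_graph_eq => c /=.
- by rewrite !dual_cornerK.
- by rewrite !petrial_cornerK.
- by rewrite -/d -/t dt td.
Qed.

Section SystemAct.

Variable E : finType.
Implicit Types (S : set_system E) (A Y : {set E}) (e f : E) (w : seq set_op).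

Definition set_op1 (x : set_op) S e :=
  match x with Star => twist [set e] S | Plus => loop_complement1 S e end.

Lemma symdiffK A : involutive (symdiff A).
Proof. by move=> Y; apply/setP => x; rewrite !in_symdiff addKb. Qed.

Lemma in_twist A S Y : (Y \in twist A S) = (symdiff A Y \in S).
Proof.
apply/imsetP/idP => [[X XS ->]|YS]; first by rewrite symdiffK.
by exists (symdiff A Y); rewrite ?symdiffK.
Qed.

Lemma in_loop_complement1 S e Y :
  (Y \in loop_complement1 S e) = (Y \in S) (+) ((e \in Y) && (Y :\ e \in S)).
Proof.
rewrite in_symdiff; congr (_ (+) _).
apply/imsetP/andP => [[X]|[eY YS]].
  by rewrite inE => /andP[XS eX] ->; rewrite setU11 setU1K.
by exists (Y :\ e); rewrite ?setD1K // inE YS !inE eqxx.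
Qed.

Lemma symdiff1D e f Y : e != f -> symdiff [set e] Y :\ f = symdiff [set e] (Y :\ f).
Proof.
move=> ef; apply/setP => x; rewrite !(in_setD1, in_symdiff) in_set1.
by case: (eqVneq x f) => [->|//]; rewrite eq_sym (negbTE ef).
Qed.

Lemma set_op1C x y e f S :
  e != f -> set_op1 x (set_op1 y S f) e = set_op1 y (set_op1 x S e) f.
Proof.
move=> ef; have fe : f != e by rewrite eq_sym.
apply/setP => Y; case: x; case: y; rewrite /= ?(in_twist, in_loop_complement1).
- congr (_ \in S); apply/setP => z; rewrite !in_symdiff; exact: addbCA.
- by rewrite !symdiff1D // in_symdiff in_set1 (negbTE fe).
- by rewrite !symdiff1D // in_symdiff in_set1 (negbTE ef).
- rewrite !in_setD1 ef fe /= setDDl setUC -setDDl.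
  by case: (e \in Y); case: (f \in Y); rewrite ?addbF //= addbACA.
Qed.

Definition set_op1s x S (s : seq E) := foldl (set_op1 x) S s.

Lemma set_op1sC x y e s S :
  e \notin s -> set_op1 x (set_op1s y S s) e = set_op1s y (set_op1 x S e) s.
Proof.
elim: s S => //= f s IH S; rewrite inE negb_or => /andP[ef es].
by rewrite IH // set_op1C.
Qed.

Lemma set_op_actE x A S : set_op_act x A S = set_op1s x S (enum A).
Proof.
case: x => //=; apply/setP => Y; rewrite in_twist.
have -> : symdiff A Y = symdiff [set z in enum A] Y.
  by congr symdiff; apply/setP => z; rewrite inE mem_enum.
elim: (enum A) (enum_uniq A) S => /= [_|e s IH /andP[es us]] S.
  by congr (_ \in S); apply/setP => z; rewrite in_symdiff !inE.
rewrite -IH // in_twist; congr (_ \in S).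
apply/setP => z; rewrite !in_symdiff !inE.
by case: (eqVneq z e) => [->|]; rewrite ?(negbTE es).
Qed.

Definition set_op1w w S e := foldl (fun S x => set_op1 x S e) S w.

Lemma set_op1_relators r S e :
  r \in relators frakS_pres -> set_op1w r S e = S.
Proof.
move=> rR; apply/setP => Y.
have [Z eZ defY] : exists2 Z : {set E}, e \notin Z & Y = Z \/ Y = e |: Z.
  case eY: (e \in Y); last by exists Y; [rewrite eY | left].
  by exists (Y :\ e); [rewrite !inE eqxx | right; rewrite setD1K].
have sU : symdiff [set e] Z = e |: Z.
  apply/setP => z; rewrite in_symdiff !inE; case: eqVneq => // ->.
  by rewrite (negbTE eZ).
have sD : symdiff [set e] (e |: Z) = Z by rewrite -sU symdiffK.
have memE := (in_twist, in_loop_complement1, sU, sD, setU11, setU1K eZ,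
  negbTE eZ).
move: rR; rewrite /= !inE => /or3P[]/eqP->; case: defY => -> /=;
  do !rewrite memE /=; by case: (Z \in S); case: (e |: Z \in S).
Qed.

Lemma set_op1wC x w e s S :
  e \notin s -> set_op1w w (set_op1s x S s) e = set_op1s x (set_op1w w S e) s.
Proof.
move=> es; elim: w S => //= y w IH S.
by rewrite /set_op1w /= -!/(set_op1w _ _ _) set_op1sC // IH.
Qed.

Lemma word_set_op_act w A S :
  word_act (@set_op_act E) w A S = foldl (set_op1w w) S (enum A).
Proof.
elim: w S => [|x w IH] S; first by elim: (enum A) S.
rewrite /word_act /= -/(word_act _ _ _ _) IH set_op_actE.
elim: (enum A) (enum_uniq A) S => //= e s IHs /andP[es us] S.
by rewrite set_op1wC // IHs.
Qed.

Lemma system_act_word w A S :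
  system_act (@word_class frakS_pres w) A S = word_act (@set_op_act E) w A S.
Proof.
apply: (@word_act_repr frakS_pres) => r {}A {}S rR; rewrite word_set_op_act.
by elim: (enum A) => //= e s IH; rewrite set_op1_relators.
Qed.

End SystemAct.

(* Main.v *)
Require Import Defs.
From mathcomp Require Import all_boot.

Set Implicit Arguments.
Unset Strict Implicit.
Unset Printing Implicit Defensive.

(** Both group actions can be computed along words in the generators, so it is
    enough to see that D turns a partial dual into a twist and a partial
    Petrial into a loop complementation.

    The key is a description of feasibility that mentions neither components
    nor numbers of curves.  A boundary curve of (V(G), B) stays in one
    component, and the component of a corner is generated by the links and by
    the four corners of each edge; hence B is feasible exactly when the four
    corners of every edge lie on one common boundary curve ([feasibleE]).
    These curves are the orbits of two involutions, [link G] and [follow B].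

    Both operations on G conjugate [link G] by an involution h that keeps every
    corner on its edge, and this amounts to conjugating [follow B] by h instead
    ([one_curve_per_edge_conj]).  For the dual, h exchanges sides and arcs at
    the edges of A, so follow B becomes the follow map of A symdiff B, which is
    the twist.

    For the Petrial at one edge e, three ways of joining the corners of e in
    pairs compete: along the arcs (e absent), along the sides (e present) and
    crosswise (e present with a half-twist).  Cut every curve at the corners of
    e: the strands that remain join the four corners in pairs, because the
    orbit of an end point of a strand under the rotation m \o l contains
    exactly one further end point ([two_ends]); moreover the pairing is one of
    the three above ([corner_pairing]).  Joining the corners along the pairing
    of the strands yields two curves through e, so this choice is infeasible;
    the two other choices yield the same curves as one another, up to the order
    in which the strands are run through.  So among the three choices an even
    number is feasible ([splice_triple]), and this is the parity rule that
    defines S + e.  A Petrial at a set is a sequence of Petrials at its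
    edges. *)

(** * Orbits of a pair of involutions *)

Definition curve (T : finType) (l m : T -> T) : rel T :=
  connect [rel x y | (y == l x) || (y == m x)].

Section Curves.

Variable T : finType.
Implicit Types (l m h : T -> T) (x y z q : T).

Lemma curvel l m x : curve l m x (l x).
Proof. by apply: connect1; rewrite /= eqxx. Qed.

Lemma curver l m x : curve l m x (m x).
Proof. by apply: connect1; rewrite /= eqxx orbT. Qed.

Lemma curve_trans l m : transitive (curve l m).
Proof. exact: connect_trans. Qed.

Lemma curve_sym l m : involutive l -> involutive m -> symmetric (curve l m).
Proof.
move=> lK mK; apply: sym_connect_sym => x y /=.
by rewrite ![y == _]eq_sym (inv_eq lK) (inv_eq mK).
Qed.

Lemma curve_min l m (r : rel T) :
  reflexive r -> transitive r -> (forall x, r x (l x)) -> (forall x, r x (m x)) ->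
  subrel (curve l m) r.
Proof.
move=> r0 rT rl rm x y /connectP[p]; elim: p x => [x _ -> //|z p IH x /=].
by case/andP=> /orP[]/eqP-> zp yE; apply: rT (IH _ zp yE).
Qed.

(** This moves an operation that relinks the free segments of the vertices onto
    the other half of the boundary curves. *)
Lemma curve_conj l m h x y : involutive h ->
  curve (h \o l \o h) m x y = curve l (h \o m \o h) (h x) (h y).
Proof.
move=> hK.
have sub l1 m1 l2 m2 : h \o l1 =1 l2 \o h -> h \o m1 =1 m2 \o h ->
    forall u v, curve l1 m1 u v -> curve l2 m2 (h u) (h v).
  move=> hl hm; apply: (@curve_min l1 m1 [rel u v | curve l2 m2 (h u) (h v)]).
  - by move=> u; apply: connect0.
  - by move=> ? ? ?; apply: curve_trans.
  - by move=> u /=; have /= -> := hl u; apply: curvel.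
  - by move=> u /=; have /= -> := hm u; apply: curver.
apply/idP/idP; first by apply: sub => u; rewrite /= !hK.
by rewrite -{2}[x]hK -{2}[y]hK; apply: sub => u; rewrite /= ?hK.
Qed.

Lemma eq_curve l m m' : m =1 m' -> curve l m =2 curve l m'.
Proof. by move=> mm; apply: eq_connect => x y /=; rewrite mm. Qed.

(** A strand is an orbit that contains a fixed point q of m.  Put s := m \o l.
    Since m and l reverse s, the orbit is the cycle of q under s, on which m
    acts as k |-> - k and l as k |-> - k - 1 modulo the length N of the cycle.
    A fixed point of m solves 2 k = 0 modulo N; and N is even, for otherwise l
    has a fixed point.  So besides k = 0 there is just k = N / 2. *)
Lemma two_ends l m q :
    involutive l -> involutive m -> (forall x, l x != x) -> m q = q ->
  exists q', [/\ q' != q, m q' = q', curve l m q q' &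
    forall x, curve l m q x -> m x = x -> x = q \/ x = q'].
Proof.
move=> lK mK lN mq; pose s := m \o l.
have sI : injective s := inj_comp (inv_inj mK) (inv_inj lK).
have iterI k : injective (iter k s) by elim: k => //= k IH x y /sI/IH.
(* m sends s^k q to s^(- k) q, stated without the inverse of s *)
have mE k : iter k s (m (iter k s q)) = q.
  elim: k => //= k IH; rewrite -iterS iterSr -[RHS]IH /s /= mK lK //.
have orbE x : curve l m q x -> fconnect s q x.
  have orb_m y : fconnect s q y -> fconnect s q (m y).
    move/iter_findex; move: (findex _ _ _) => k <-; rewrite fconnect_sym //.
    by have := fconnect_iter s k (m (iter k s q)); rewrite mE.
  have orb_l y : fconnect s q y -> fconnect s q (l y).
    move=> qy; rewrite -[l y]mK; apply: orb_m; apply: connect_trans qy _.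
    exact: fconnect1.
  suff /[apply]: subrel (curve l m) [rel y z | fconnect s q y ==> fconnect s q z].
    by rewrite /= connect0.
  apply: curve_min => [y|y z t|y|y] /=; first exact: implybb.
  - by move=> /implyP zy /implyP yt; apply/implyP=> /zy/yt.
  - exact/implyP/orb_l.
  - exact/implyP/orb_m.
have curve_iter k : curve l m q (iter k s q).
  elim: k => [|k IH]; first exact: connect0.
  exact: curve_trans (curve_trans IH (curvel _ _ _)) (curver _ _ _).
have N0 : 0 < order s q := order_gt0 s q.
have Nq : iter (order s q) s q = q := iter_order sI q.
have ltN k : k < order s q -> iter k s q = q -> k = 0.
  by move=> /findex_iter kE kq; rewrite kq findex0 in kE.
pose j := (order s q)./2.
have NE : order s q = j.*2.
  (* if N = 2 j + 1, then l fixes s^j q *)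
  rewrite -[LHS]odd_double_half -/j; case odd_N: (odd _) => //; exfalso.
  have /negP[] := lN (iter j s q); apply/eqP/(iterI j.+1).
  rewrite -[l _]mK [m (l _)]/(s _) -iterS mE -iterD addSn addnn -[LHS]Nq.
  by rewrite -[in LHS](odd_double_half (order s q)) odd_N.
have j0 : 0 < j by rewrite -double_gt0 -NE.
have jN : j < order s q by rewrite NE -addnn -{1}[j]addn0 ltn_add2l.
exists (iter j s q); split=> // [||x qx mx].
- by apply/eqP=> /(ltN _ jN) jE; rewrite jE in j0.
- by apply: (iterI j); rewrite mE -iterD addnn -NE Nq.
have {}qx := orbE _ qx; have := findex_max qx; have := iter_findex qx.
move: (findex _ _ _) => k xE kN; have := mE k.
rewrite xE mx -xE -iterD addnn => kk.
case: (ltnP k.*2 (order s q)) => [/ltN/(_ kk)/eqP|Nk].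
  by rewrite double_eq0 => /eqP->; left.
right; congr (iter _ s q); apply: double_inj; rewrite -NE -[LHS](subnK Nk).
rewrite (ltN (k.*2 - order s q)) //.
  by rewrite ltn_subLR // addnn ltn_double.
by rewrite -[X in iter _ _ X = _]Nq -iterD subnK.
Qed.

End Curves.

(** * Feasible sets and boundary curves *)

Section Corners.

Variable E : finType.
Implicit Types (A B : {set E}) (e : E) (c d : corner E) (k : bool * bool).
Implicit Types (G : ribbon_graph E) (l m f h : corner E -> corner E).

Definition one_curve_per_edge l m :=
  [forall c : corner E, forall d : corner E,
     (c.1.1 == d.1.1) ==> curve l m c d].

Lemma one_curve_per_edgeP l m :
  reflect (forall c d, c.1.1 = d.1.1 -> curve l m c d) (one_curve_per_edge l m).
Proof.
apply: (iffP forallP) => [H c d /eqP|H c].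
  by apply/implyP; apply: (forallP (H c)).
by apply/forallP=> d; apply/implyP=> /eqP; apply: H.
Qed.

Lemma eq_one_curve_per_edge l m m' :
  m =1 m' -> one_curve_per_edge l m = one_curve_per_edge l m'.
Proof.
by move=> mm; do 2!apply: eq_forallb => ?; rewrite (eq_curve _ mm).
Qed.

Lemma one_curve_per_edge_conj l m h :
    involutive h -> (forall c, (h c).1.1 = c.1.1) ->
  one_curve_per_edge (h \o l \o h) m = one_curve_per_edge l (h \o m \o h).
Proof.
move=> hK hE; apply/one_curve_per_edgeP/one_curve_per_edgeP => H c d cd.
  by rewrite -[c]hK -[d]hK -curve_conj //; apply: H; rewrite !hE.
by rewrite curve_conj //; apply: H; rewrite !hE.
Qed.

Lemma connect_site G l m c d :
  connect (@site_step _ G [:: l; m]) (inl c) (inl d) = curve l m c d.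
Proof.
apply/idP/idP; last first.
  apply: (@curve_min _ l m [rel c d | connect (@site_step _ G [:: l; m])
                                        (inl c) (inl d)]) => [x|x y z|x|x].
  - exact: connect0.
  - exact: connect_trans.
  - by apply: connect1; rewrite /site_step /= eqxx.
  - by apply: connect1; rewrite /site_step /= eqxx orbT.
case/connectP=> p; elim: p c => [c _ [->]|x p IH c /= /andP[]].
  exact: connect0.
by rewrite /site_step /= orbF => /orP[]/eqP-> /IH{}IH /IH;
  apply: curve_trans; rewrite (curvel, curver).
Qed.

Lemma site_moveK G f : involutive f -> involutive (@site_move _ G f).
Proof. by move=> fK [c|v] //=; rewrite fK. Qed.

Lemma follow_edge B c : (follow B c).1.1 = c.1.1.
Proof. by case: c => [[e i] j]; rewrite /follow /=; case: ifP. Qed.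

(** Arcs and sides together connect the four corners of an edge. *)
Lemma connect_component G c d : c.1.1 = d.1.1 ->
  connect (@site_step _ G [:: link G; @across_arc E; @along_side E])
    (inl c) (inl d).
Proof.
set r := site_step _; have ra x : connect r (inl x) (inl (across_arc x)).
  by apply: connect1; rewrite /r /site_step /= eqxx !orbT.
have rs x : connect r (inl x) (inl (along_side x)).
  by apply: connect1; rewrite /r /site_step /= eqxx !orbT.
case: c d => [[e i] j] [[_ i'] j'] /= <-.
have {ra} ra : connect r (inl (e, i, j)) (inl (e, i, j')).
  by case: (eqVneq j j') => [->//|/negbTE jj]; have := ra (e, i, j);
     rewrite /= -[~~ j](addTb j); case: j j' jj => [] [].
apply: connect_trans ra _.
by have := rs (e, i, j'); case: i i' => [] [] //= _; apply: connect0.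
Qed.

(** Boundary curves refine components, so a component contains one curve only
    if and only if the moves that generate components do not leave curves; the
    moves that matter are those between corners of one edge.  An isolated
    vertex is a component with one curve whatever B is. *)
Lemma feasibleE G B :
  (B \in delta_matroid G) = one_curve_per_edge (link G) (follow B).
Proof.
pose K := connect (@site_step _ G [:: link G; @across_arc E; @along_side E]).
pose b := connect (@site_step _ G [:: link G; follow B]).
have linkI := site_moveK (G := G) (@linkK _ G).
have acrossI := site_moveK (G := G) (@across_arcK E).
have alongI := site_moveK (G := G) (@along_sideK E).
have followI := site_moveK (G := G) (followK B).
have Ksym x y : K x y = K y x.
  apply: sym_connect_sym x y => x y; rewrite /site_step /= !orbF.
  by rewrite ![y == _]eq_sym (inv_eq linkI) (inv_eq acrossI) (inv_eq alongI).
have bsym x y : b x y = b y x.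
  apply: sym_connect_sym x y => x y; rewrite /site_step /= !orbF.
  by rewrite ![y == _]eq_sym (inv_eq linkI) (inv_eq followI).
have bK x y : b x y -> K x y.
  apply: connect_sub x y => x y; rewrite /site_step /= orbF => /orP[]/eqP->.
    by apply: connect1; rewrite /site_step /= eqxx.
  case: x => [c|v] /=; last exact: connect0.
  by apply: connect_component; rewrite follow_edge.
rewrite inE; apply/forall_inP/one_curve_per_edgeP => [H c d cd|H _ /imsetP[x _ ->]].
  rewrite -(@connect_site G).
  have Kc : [set y | K (inl c) y] \in components G by apply: imset_f.
  have /cards1P[p pE] := H _ Kc.
  have pieceE y : K (inl c) y -> [set z | b y z] = p.
    move=> cy; apply/set1P; rewrite -pE inE; apply/andP; split.
      exact: (imset_f (fun x => [set y | b x y])).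
    by apply/subsetP=> z; rewrite !inE => /bK; apply: connect_trans.
  have /setP/(_ (inl d)) : [set z | b (inl c) z] = [set z | b (inl d) z].
    by rewrite !pieceE //; [apply: connect_component | apply: connect0].
  by rewrite !inE [b (inl d) _]connect0.
have Kb y z : K y z -> b y z.
  apply: connect_sub y z => y z; rewrite /site_step /= orbF => /or3P[]/eqP->.
  - by apply: connect1; rewrite /site_step /= eqxx.
  - case: y => [c|v] /=; last exact: connect0.
    by rewrite connect_site; apply: H; case: c => [[]].
  - case: y => [c|v] /=; last exact: connect0.
    by rewrite connect_site; apply: H; case: c => [[]].
apply/cards1P; exists [set y | b x y]; apply/setP=> p; rewrite !inE.
apply/andP/eqP => [[/imsetP[y _ ->] /subsetP sub]|->].
  have /Kb xy : K x y by have := sub y; rewrite !inE; apply; apply: connect0.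
  apply/setP=> z; rewrite !inE; apply/idP/idP; first exact: connect_trans.
  by apply: connect_trans; rewrite -/(b y x) bsym.
split; first exact: (imset_f (fun x => [set y | b x y])).
by apply/subsetP=> z; rewrite !inE; apply: bK.
Qed.

(** Exchanging the roles of i and j in a corner (e, i, j) exchanges following
    the side of e with following its arc, that is, e in B with e not in B. *)
Lemma delta_matroid_partial_dual A G :
  delta_matroid (partial_dual A G) = twist A (delta_matroid G).
Proof.
apply/setP=> B; rewrite in_twist !feasibleE.
rewrite (@one_curve_per_edge_conj (link G) (follow B) (dual_corner A)); first 1 last.
- exact: dual_cornerK.
- by case=> [[e i] j] /=; case: ifP.
apply: eq_one_curve_per_edge => -[[e i] j] /=; rewrite /follow in_symdiff /=.
case eA: (e \in A); case: (e \in B); rewrite /= ?eA //.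
Qed.

(** * Three ways of joining the corners of an edge *)

(** The Klein four-group acts on the corners of each edge; its three nontrivial
    elements are the three perfect matchings of these corners. *)
Definition shift k c : corner E := (c.1.1, c.1.2 (+) k.1, c.2 (+) k.2).

(** With k = (true, false) the corners of e are joined along its sides, with
    (false, true) along its arcs, with (true, true) crosswise; with
    (false, false) they are not joined, and the curves through e are cut into
    strands that end at its corners. *)
Definition splice B e k c := if c.1.1 == e then shift k c else follow B c.

Lemma spliceK B e k : involutive (splice B e k).
Proof.
case=> [[f i] j]; rewrite /splice /=; case: (eqVneq f e) => [->|fe] /=.
  by rewrite eqxx /shift /= !addbK.
by rewrite follow_edge /= (negbTE fe) followK.
Qed.

Lemma follow_splice B e :
  follow B =1 splice B e (if e \in B then (true, false) else (false, true)).
Proof.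
case=> [[f i] j]; rewrite /splice /=; case: eqVneq => [->|//].
by rewrite /follow /shift /=; case: ifP; rewrite /= addbF addbT.
Qed.

(** The set B :\ e appears as a splice of B, so that the three competing choices
    at e differ in k alone. *)
Lemma follow_setD1_splice B e : follow (B :\ e) =1 splice B e (false, true).
Proof.
case=> [[f i] j]; rewrite /splice /follow /= !inE.
by case: eqVneq => [->|//]; rewrite /shift /= addbF addbT.
Qed.

(** The half-twist turns the sides of e into the diagonals of its corners, and
    preserves its arcs. *)
Lemma petrial_follow_splice B e :
  let t := petrial_corner (fun=> true) [set e] in
  t \o follow B \o t =1
  splice B e (if e \in B then (true, true) else (false, true)).
Proof.
move=> t [[f i] j]; rewrite /t /splice /follow /shift /= !inE.
case: (eqVneq f e) => [->|/negbTE fe] /=; last by case: ifP; rewrite /= !inE fe.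
by case: i; case: ifP => eB; rewrite /= ?eB /= !inE eqxx //= ?negbK ?addbF ?addbT.
Qed.

Lemma shift_onto c d :
  c.1.1 = d.1.1 -> d = shift (c.1.2 (+) d.1.2, c.2 (+) d.2) c.
Proof. by case: c d => [[e i] j] [[f i'] j'] /= ->; rewrite /shift /= !addKb. Qed.

Lemma shift_shift k k' c :
  shift k (shift k' c) = shift (k'.1 (+) k.1, k'.2 (+) k.2) c.
Proof. by rewrite /shift /= !addbA. Qed.

Lemma splice0_fixed B e c :
  (splice B e (false, false) c == c) = (c.1.1 == e).
Proof.
case: c => [[f i] j]; rewrite /splice /=; case: (eqVneq f e) => [_|fe].
  by rewrite /shift /= !addbF eqxx.
by rewrite /follow /=; case: ifP => _ /=; rewrite !xpair_eqE;
  case: i; case: j; rewrite /= ?andbF.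
Qed.

(** By [two_ends] each corner c of e is joined by a strand to exactly one other,
    say [shift h c].  That h does not depend on c holds because two disjoint
    pairs among four points are the two classes of a nontrivial element of the
    Klein four-group. *)
Lemma corner_pairing l B e : involutive l -> (forall c, l c != c) ->
  exists2 k, k != (false, false) &
    forall c d, c.1.1 = e -> d.1.1 = e ->
      curve l (splice B e (false, false)) c d = (d == c) || (d == shift k c).
Proof.
move=> lK lN; set m := splice B e _.
have mK : involutive m := spliceK B e _.
have pair1 c : c.1.1 = e -> exists2 k, k != (false, false) &
    forall d, d.1.1 = e -> curve l m c d = (d == c) || (d == shift k c).
  move=> ce; have /eqP mc : m c == c by rewrite splice0_fixed ce.
  have [d [dc md cd dP]] := two_ends lK mK lN mc.
  have de : d.1.1 = e by apply/eqP; rewrite -(splice0_fixed B) -/m md.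
  have dE := shift_onto (etrans ce (esym de)).
  exists (c.1.2 (+) d.1.2, c.2 (+) d.2).
    apply: contraNneq dc => -[k1 k2]; rewrite dE k1 k2 /shift !addbF.
    by case: (c) => [[]].
  move=> x xe; rewrite -dE; apply/idP/orP => [cx|[]/eqP-> //].
    have mx : m x = x by apply/eqP; rewrite splice0_fixed xe.
    by case: (dP x cx mx) => ->; rewrite eqxx; [left | right].
  exact: connect0.
have [k k0 kP] := pair1 (e, false, false) erefl; exists k => // c d ce de.
have [h h0 hP] := pair1 c ce; rewrite hP //; suff -> : h = k by [].
set q := (e, false, false).
have hq : curve l m q (shift h c) -> curve l m q c.
  by move/curve_trans; apply; rewrite curve_sym // hP // eqxx orbT.
have cq : curve l m q c -> curve l m c q && curve l m c (shift k q).
  rewrite curve_sym // => cq; rewrite cq; apply: curve_trans cq _.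
  by rewrite kP // eqxx orbT.
case: c ce hP {pair1} hq cq => [[f i] j] /= -> hP.
rewrite !kP // !hP // /shift /= !xpair_eqE !eqxx {q kP hP}.
(* hq and cq are now statements about the bits of k, h and c *)
by case: k h k0 h0 => [[] []] [[] []] //= _ _; case: i; case: j => //= A C;
   (have := A isT) || have := C isT.
Qed.

(** Joining strands at their ends keeps each strand on one curve. *)
Lemma curve0_splice l B e k c d :
  curve l (splice B e (false, false)) c d -> curve l (splice B e k) c d.
Proof.
apply: curve_min c d => [x|x y z|x|x]; first exact: connect0.
- exact: curve_trans.
- exact: curvel.
case: (eqVneq x.1.1 e) => [xe|/negbTE xe]; last first.
  by have := curver l (splice B e k) x; rewrite /splice xe.
have /eqP -> : splice B e (false, false) x == x by rewrite splice0_fixed xe.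
exact: connect0.
Qed.

(** Let k be the pairing of the corners of e by strands.  Splicing with k closes
    the strands, so that the corners of e stay on two curves.  If k1 and k2 are
    the other two matchings, then k1 = k + k2, so a k1-move is a k2-move
    followed by a run along a strand; thus k1 and k2 give the same curves. *)
Lemma splice_triple l B e : involutive l -> (forall c, l c != c) ->
  one_curve_per_edge l (splice B e (true, true)) =
  one_curve_per_edge l (splice B e (true, false)) (+)
  one_curve_per_edge l (splice B e (false, true)).
Proof.
move=> lK lN; have [k k0 kP] := corner_pairing B e lK lN.
have kshift c : c.1.1 = e -> curve l (splice B e (false, false)) c (shift k c).
  by move=> ce; rewrite kP ?eqxx ?orbT.
have whole k' : k' != (false, false) -> k' != k ->
    one_curve_per_edge l (splice B e k) = false.
  move=> k'0 k'k; apply/negP=> /one_curve_per_edgeP H.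
  pose c : corner E := (e, false, false).
  (* splicing with k adds only moves between the two ends of a strand *)
  have sub x y : curve l (splice B e k) x y ->
                 curve l (splice B e (false, false)) x y.
    apply: curve_min x y => [x|x y z|x|x]; first exact: connect0.
    - exact: curve_trans.
    - exact: curvel.
    rewrite [splice B e k x]/splice; case: eqVneq => [/kshift //|/negbTE xe].
    by have := curver l (splice B e (false, false)) x; rewrite /splice xe.
  have := sub c (shift k' c) (H c (shift k' c) erefl); rewrite kP //.
  rewrite /shift !xpair_eqE !eqxx /=.
  by case: k k' k'0 k'k {k0 kP kshift H sub} => [[] []] [[] []].
have swap k1 k2 : k = (k2.1 (+) k1.1, k2.2 (+) k1.2) ->
    one_curve_per_edge l (splice B e k1) ->
    one_curve_per_edge l (splice B e k2).
  move=> kE /one_curve_per_edgeP H; apply/one_curve_per_edgeP=> c d /H.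
  apply: curve_min c d => [x|x y z|x|x]; first exact: connect0.
  - exact: curve_trans.
  - exact: curvel.
  have := curver l (splice B e k2) x; rewrite {2}/splice [splice B e k1 x]/splice.
  case: eqVneq => // xe; move/curve_trans; apply.
  have -> : shift k1 x = shift k (shift k2 x).
    by rewrite shift_shift kE /shift /= !addKb.
  exact/curve0_splice/kshift.
set P := fun k' => one_curve_per_edge l (splice B e k').
have {}swap k1 k2 : k = (k2.1 (+) k1.1, k2.2 (+) k1.2) -> P k1 = P k2.
  move=> kE; apply/idP/idP; apply: swap; rewrite // kE.
  by congr pair; apply: addbC.
have {}whole k' : k' != (false, false) -> k' != k -> P k = false := @whole k'.
rewrite -!/(P _); clearbody P; case: k k0 {kP kshift} whole swap => [[] []] //= _ whole swap.
- by rewrite (whole (true, false)) // (swap (true, false) (false, true)) ?addbb.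
- by rewrite (whole (true, true)) // (swap (true, true) (false, true)).
- by rewrite (whole (true, true)) // addbF (swap (true, true) (true, false)).
Qed.

(** * Partial Petrials *)

Lemma delta_matroid_partial_petrial1 e G :
  delta_matroid (partial_petrial [set e] G) =
  loop_complement1 (delta_matroid G) e.
Proof.
apply/setP=> B; rewrite in_loop_complement1 !feasibleE.
pose t := petrial_corner (fun=> true) [set e].
rewrite (@one_curve_per_edge_conj (link G) (follow B) t); first 1 last.
- exact: petrial_cornerK.
- by case=> [[f i] j] /=; case: ifP.
rewrite (eq_one_curve_per_edge _ (petrial_follow_splice B e)).
rewrite (eq_one_curve_per_edge _ (follow_splice B e)).
rewrite (eq_one_curve_per_edge _ (follow_setD1_splice B e)).
case: ifP => _; last by rewrite addbF.
exact: splice_triple (@linkK _ G) (@link_neq _ G).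
Qed.

Lemma partial_petrial0 G : partial_petrial set0 G = G.
Proof.
case: G => I l lK lN; apply: ribbon_graph_eq => c /=.
have t0 x : petrial_corner (fun=> true) set0 x = x :> corner E.
  by case: x => [[f i] j] /=; rewrite inE.
by rewrite !t0.
Qed.

Lemma partial_petrialU1 e A G : e \notin A ->
  partial_petrial (e |: A) G = partial_petrial A (partial_petrial [set e] G).
Proof.
move=> eA; apply: ribbon_graph_eq => c /=.
have tE x : petrial_corner (fun=> true) (e |: A) x =
    petrial_corner (fun=> true) A (petrial_corner (fun=> true) [set e] x).
  case: x => [[f i] j] /=; rewrite !inE; case: (eqVneq f e) => [->|fe] //=.
  by case: i; rewrite /= (negbTE eA).
have tE' x : petrial_corner (fun=> true) (e |: A) x =
    petrial_corner (fun=> true) [set e] (petrial_corner (fun=> true) A x).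
  case: x => [[f i] j] /=; rewrite !inE; case: (eqVneq f e) => [->|fe] //=.
    by rewrite (negbTE eA) /= inE eqxx.
  by case: ifP => _; rewrite /= inE (negbTE fe).
by rewrite tE tE'.
Qed.

Lemma delta_matroid_partial_petrial A G :
  delta_matroid (partial_petrial A G) = loop_complement A (delta_matroid G).
Proof.
rewrite /loop_complement -{1}[A]set_enum.
elim: (enum A) (enum_uniq A) G => [_ G|e s IH /= /andP[es us] G] /=.
  by rewrite set_nil partial_petrial0.
by rewrite set_cons partial_petrialU1 ?inE // IH // delta_matroid_partial_petrial1.
Qed.

(** * Words and group elements *)

Lemma delta_matroid_word (w : seq ribbon_op) A G :
  delta_matroid (word_act (@ribbon_op_act E) w A G) =
  word_act (@set_op_act E) (map eta_gen w) A (delta_matroid G).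
Proof.
elim: w G => //= x w IH G; rewrite /word_act /= -!/(word_act _ _ _ _) IH.
congr (word_act _ _ _ _).
by case: x; [exact: delta_matroid_partial_dual | exact: delta_matroid_partial_petrial].
Qed.

End Corners.

(** The hypotheses on eta determine it, as delta and tau generate. *)
Lemma eta_word_class (eta : {multiplicative frakG -> frakS}) :
  eta delta = star -> eta tau = plus ->
  forall w : seq ribbon_op,
    eta (@word_class frakG_pres w) = @word_class frakS_pres (map eta_gen w).
Proof.
move=> etad etat; elim=> [|x w IH]; first by apply: (mulgI (eta 1%g)); rewrite -gmulfM !mulg1.
rewrite -cat1s map_cat (@word_classM frakG_pres) gmulfM IH.
rewrite (@word_classM frakS_pres); congr (_ * _)%g.
by case: x; [exact: etad | exact: etat].
Qed.

Theorem theorem4p3 (eta : {multiplicative frakG -> frakS})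
  (eta_delta : eta delta = star) (eta_tau : eta tau = plus)
  (E : finType) (G : ribbon_graph E) (n : nat)
  (A : 'I_n -> {set E}) (g : 'I_n -> frakG) :
  delta_matroid (iter_act (@ribbon_act E) g A G) =
  iter_act (@system_act E) (fun i => eta (g i)) A (delta_matroid G).
Proof.
rewrite /iter_act; elim: (enum 'I_n) G => //= i s IH G; rewrite IH.
congr foldl; rewrite -[g i]repr_word_class eta_word_class //.
by rewrite ribbon_act_word system_act_word delta_matroid_word.
Qed.
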